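(* Let $K$ be an algebraically closed field of characteristic zero, let $q\in K\setminus\{0\}$ not be a root of unity, and let $\theta_x\in\{\sigma_x,\tau_{q,x}\}$. Let $f,g\in K(x,y)$ satisfy $\theta_x(f)-f=D_y(g)$. Then there exist $h\in K(x,y)$, $u\in K(y)$ and $v\in K(x)$ such that \[ f=D_y(h)+u\quad\text{and}\quad g=\theta_x(h)-h+v. \]
   Context: $D_y=\partial/\partial y$ is the usual derivation on $K(x,y)$; $\sigma_x(f(x,y))=f(x+1,y)$ and $\tau_{q,x}(f(x,y))=f(qx,y)$. *)

(* Defs.v *)
From mathcomp Require Import all_boot all_order all_algebra.
From mathcomp Require Import ring.

Set Implicit Arguments.
Unset Strict Implicit.
Unset Printing Implicit Defensive.

Import GRing.Theory.
Local Open Scope ring_scope.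
Local Open Scope quotient_scope.

Notation "x %:F" := (FracField.tofrac x) : ring_scope.

(* Meaningful for an injective ring morphism [phi] only; then it is the unique
   extension of [phi] to the fraction fields, see [fracmap_div]. *)
Definition fracmap (R S : idomainType) (phi : R -> S) (f : {fraction R}) :
    {fraction S} :=
  (phi \n_(repr f))%:F / (phi \d_(repr f))%:F.

(* K(x,y) as the fraction field of K[x][y]: the inner variable is x, the outer
   one is y. *)
Notation ratxy K := {fraction {poly {poly K}}}.

Section RationalFunctions.
Variable K : fieldType.

Definition ofKx : {fraction {poly K}} -> ratxy K :=
  fracmap (polyC : {poly K} -> {poly {poly K}}).

Definition ofKy : {fraction {poly K}} -> ratxy K :=
  fracmap (map_poly polyC : {poly K} -> {poly {poly K}}).

Definition sigmax : ratxy K -> ratxy K :=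
  fracmap (map_poly (comp_poly ('X + 1 : {poly K}))).

(* Meaningful for [q != 0] only. *)
Definition taux (q : K) : ratxy K -> ratxy K :=
  fracmap (map_poly (comp_poly (q *: 'X : {poly K}))).

(* Quotient rule; independent of the chosen representative by [Dy_div]. *)
Definition Dy (f : ratxy K) : ratxy K :=
  let n := \n_(repr f) in let d := \d_(repr f) in
  (n^`() * d - n * d^`())%:F / (d ^+ 2)%:F.

End RationalFunctions.

Lemma reprE (R : idomainType) (n d : R) : d != 0 ->
  \n_(repr (n%:F / d%:F)) * d = \d_(repr (n%:F / d%:F)) * n.
Proof.
move=> d0; set f := n%:F / d%:F.
have fE : f = \pi_(FracField.type R) (Ratio n d).
  rewrite /f; unlock FracField.tofrac.
  rewrite -[(_)^-1]FracField.pi_inv -[LHS]FracField.pi_mul; congr (\pi_(_) _).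
  rewrite /FracField.mulf /FracField.invf.
  by rewrite !numden_Ratio ?oner_eq0 // mulr1 mul1r.
have := FracField.equivf_l (Ratio n d).
by rewrite -fE !numden_Ratio.
Qed.

Lemma fracmap_div (R S : idomainType) (phi : {rmorphism R -> S}) (n d : R) :
  injective phi -> d != 0 ->
  fracmap phi (n%:F / d%:F) = (phi n)%:F / (phi d)%:F.
Proof.
move=> phi_inj d0; rewrite /fracmap; set r := repr _.
have nz x : x != 0 -> (phi x)%:F != 0.
  by move=> x0; rewrite tofrac_eq0 -(rmorph0 phi) (inj_eq phi_inj).
apply/eqP; rewrite eqr_div ?nz //; last exact: denom_ratioP.
by rewrite -!tofracM -!rmorphM tofrac_eq reprE // mulrC.
Qed.

Lemma Dy_div (K : fieldType) (n d : {poly {poly K}}) : d != 0 ->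
  Dy (n%:F / d%:F) = (n^`() * d - n * d^`())%:F / (d ^+ 2)%:F.
Proof.
move=> d0; rewrite /Dy; have := reprE n d0.
have := denom_ratioP (repr (n%:F / d%:F)).
move: (\n__) (\d__) => N D D0 E.
apply/eqP; rewrite eqr_div ?tofrac_eq0 ?expf_neq0 // -!tofracM tofrac_eq.
have E' : N^`() * d = D^`() * n + D * n^`() - N * d^`().
  by rewrite -derivM -E derivM addrK.
apply/eqP.
have -> : (N^`() * D - N * D^`()) * d ^+ 2
  = (N^`() * d) * D * d - (N * d) * D^`() * d by ring.
rewrite E' E.
have -> : (D^`() * n + D * n^`() - N * d^`()) * D * d - D * n * D^`() * d
  = D ^+ 2 * n^`() * d - (N * d) * d^`() * D by ring.
by rewrite E; ring.
Qed.

Lemma polyC_map_inj (K : fieldType) :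
  injective (map_poly polyC : {poly K} -> {poly {poly K}}).
Proof. exact/map_inj_poly/polyC0/polyC_inj. Qed.

Lemma comp_poly_lin_inj (K : fieldType) (a b : K) : a != 0 ->
  injective (comp_poly (a *: 'X + b%:P)).
Proof.
move=> a0; apply: (can_inj (g := comp_poly (a^-1 *: ('X - b%:P)))) => p.
rewrite -comp_polyA comp_polyD comp_polyZ comp_polyX comp_polyC.
by rewrite scalerA divff // scale1r subrK comp_polyXr.
Qed.

Lemma sigmax_inj (K : fieldType) :
  injective (map_poly (comp_poly ('X + 1 : {poly K}))).
Proof.
apply: map_inj_poly; last exact: comp_poly0.
by have := @comp_poly_lin_inj K 1 1 (oner_neq0 _); rewrite scale1r.
Qed.

Lemma taux_inj (K : fieldType) (q : K) : q != 0 ->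
  injective (map_poly (comp_poly (q *: 'X : {poly K}))).
Proof.
move=> q0; apply: map_inj_poly; last exact: comp_poly0.
by have := @comp_poly_lin_inj K q 0 q0; rewrite addr0.
Qed.

(* Main.v *)
Require Import Defs.
From HB Require Import structures.
From mathcomp Require Import all_boot all_order all_algebra.
From mathcomp Require Import separable ring.

(* By Hermite reduction over K(x), f = Dy h + r where r is a proper fraction
   with squarefree denominator in y. Then theta r - r is again such a fraction,
   and it is also a derivative; since derivatives have no simple poles,
   theta r = r. Fixing a reduced fraction with monic denominator means fixing
   its coefficients in K(x), and the elements of K(x) fixed by theta are
   constants, so r lies in K(y). Finally g - (theta h - h) is killed by Dy,
   hence lies in K(x). *)

Set Implicit Arguments.
Unset Strict Implicit.
Unset Printing Implicit Defensive.

Import GRing.Theory.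
Local Open Scope ring_scope.

(** * Hermite reduction and squarefree denominators over a field of characteristic zero *)

Section PolynomialsInCharacteristicZero.
Variable L : fieldType.
Implicit Types p q a b c d : {poly L}.

Lemma coprime_fraction a b : b != 0 ->
  exists c d, [/\ d \is monic, coprimep c d & a * d = c * b].
Proof.
move=> b0; set k := gcdp a b.
have k0 : k != 0 by rewrite gcdp_eq0 negb_and b0 orbT.
have bE : b %/ k * k = b by apply/divpK/dvdp_gcdr.
have aE : a %/ k * k = a by apply/divpK/dvdp_gcdl.
have l0 : (lead_coef (b %/ k))^-1 != 0.
  rewrite invr_eq0 lead_coef_eq0; apply: contraNneq b0 => E.
  by rewrite -bE E mul0r.
exists ((lead_coef (b %/ k))^-1 *: (a %/ k)),
  ((lead_coef (b %/ k))^-1 *: (b %/ k)).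
split; first by rewrite monicE lead_coefZ mulVf // -invr_eq0.
  by rewrite coprimepZl // coprimepZr // coprimep_div_gcd // b0 orbT.
rewrite -[X in X * _]aE -[X in _ = _ * X]bE -!scalerAr -!scalerAl.
by congr (_ *: _); ring.
Qed.

Hypothesis charL : [pchar L] =i pred0.

Lemma natr_neq0 n : n.+1%:R != 0 :> L.
Proof. by rewrite (pcharf0P L).1. Qed.

Lemma deriv_eq0 p : p^`() = 0 -> exists k, p = k%:P.
Proof.
move=> p'0; exists p`_0; apply/polyP => -[|i]; rewrite coefC //=.
have /eqP := coef_deriv p i; rewrite p'0 coef0 eq_sym -mulr_natr mulf_eq0.
by rewrite (negPf (natr_neq0 i)) orbF => /eqP.
Qed.

Lemma dvd_deriv_eq0 p : p %| p^`() -> p^`() = 0.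
Proof.
move=> pp'; apply/eqP; apply: contraTT pp' => p'0.
rewrite gtNdvdp // lt_size_deriv //.
by apply: contraNneq p'0 => ->; rewrite deriv0.
Qed.

Lemma deriv_surj p : exists q, q^`() = p.
Proof.
(* At [i = 0] the division is by [0%:R], whose inverse is [0] by convention; this constant term
   disappears on differentiation. *)
exists (\poly_(i < (size p).+1) (p`_i.-1 / i%:R)).
apply/polyP => i; rewrite coef_deriv coef_poly ltnS; case: ltnP => [_|le_p_i].
  by rewrite -[LHS]mulr_natr divfK ?natr_neq0.
by rewrite mul0rn nth_default.
Qed.

(** Here [k] is the gcd of [p] and its derivative: it takes up the repeated factors, so [s] is the
    squarefree part of [p]. *)
Lemma coprime_gcd_deriv p : p != 0 ->
  exists k s w, [/\ p = k * s, p^`() = k * w, coprimep s w & separable_poly s].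
Proof.
move=> p0; set k := gcdp p p^`().
exists k, (p %/ k), (p^`() %/ k); split.
- by rewrite mulrC divpK // dvdp_gcdl.
- by rewrite mulrC divpK // dvdp_gcdr.
- by rewrite coprimep_div_gcd // p0.
- exact: make_separable.
Qed.

(* One step of Mack's variant of Hermite reduction: it rewrites [a / b] as
   [(c / g)^`() + d / (k * s)]. *)
Lemma hermite_step a b : b != 0 -> ~~ separable_poly b ->
  exists g s k c d,
    [/\ b = g * s, k * s != 0, (size (k * s)%R < size b)%N
      & a * g * k = (c^`() * g - c * g^`()) * s * k + d * g ^+ 2].
Proof.
move=> b0 nsep; have [g [s [w [bE b'E cop sep]]]] := coprime_gcd_deriv b0.
have [g0 s0] : g != 0 /\ s != 0.
  by apply/andP; rewrite -negb_or -mulf_eq0 -bE.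
have [k [p [v [gE g'E copv _]]]] := coprime_gcd_deriv g0.
have [k0 p0] : k != 0 /\ p != 0.
  by apply/andP; rewrite -negb_or -mulf_eq0 -gE.
(* Since [g] divides the derivative of [b = g * s], it divides its own derivative times [s];
   cancelling [k] leaves [p %| v * s]. *)
have /dvdpP[e sE] : p %| s.
  rewrite -(Gauss_dvdpr _ copv) -(dvdp_mul2l _ _ k0) mulrA -g'E -gE.
  have -> : g^`() * s = g * (w - s^`()).
    by apply: (addIr (g * s^`())); rewrite -derivM -bE b'E; ring.
  exact: dvdp_mulr.
have copve : coprimep (v * e) p.
  rewrite coprimepMl coprimep_sym copv /=.
  by move: sep; rewrite sE separable_mul => /and3P[].
have [[c d] /= ced] := Bezout_eq1_coprimepP _ _ copve.
(* If [p] were constant, [g] would divide its derivative, hence be constant, and [b] would be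
   separable like [s]. *)
have p1 : (1 < size p)%N.
  rewrite ltn_neqAle size_poly_gt0 p0 andbT eq_sym; apply: contra nsep => p1.
  have gk : g %| k by rewrite gE -[X in _ %| X]mulr1 dvdp_mul2l // dvdp1.
  have [l gl] : exists l, g = l%:P.
    by apply/deriv_eq0/dvd_deriv_eq0; rewrite g'E dvdp_mulr.
  have l0 : l != 0 by rewrite -polyC_eq0 -gl.
  by rewrite bE gl mul_polyC (eqp_separable (eqp_scale s l0)).
(* Integration by parts: multiply [a / b] by [c * (v * e) + d * p = 1] and note that
   [v * e / (g * s)] is minus the derivative of [1 / g]. The remaining term over [g = k * p] is
   brought over [k * s] by the factor [e], as [s = e * p]. *)
exists g, s, k, (- (a * c)), (a * d + (a * c)^`() * e); split => //.
- exact: mulf_neq0.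
- rewrite bE !size_mul // gE size_mul //.
  move: p1 s0 k0; rewrite -!size_poly_gt0.
  case: (size p) => [|[|n]] // _; case: (size s) => // m _.
  case: (size k) => // i _.
  by rewrite !addSn !addnS /= !addSn !ltnS leq_add2r leq_addr.
rewrite derivN g'E sE gE -[X in X * _ * k]mulr1 -ced.
by ring.
Qed.

(* The hypothesis says [c / d = (n / m)^`()]: a squarefree denominator has only
   simple poles, whereas those of a derivative are multiple. *)
Lemma simple_derivative_eq0 c d n m : separable_poly d -> (size c < size d)%N ->
  m != 0 -> coprimep n m ->
  c * m ^+ 2 = d * (n^`() * m - n * m^`()) -> c = 0.
Proof.
move=> sepd ltcd m0 copnm E.
have [k [s [w [mE m'E cop _]]]] := coprime_gcd_deriv m0.
have [k0 s0] : k != 0 /\ s != 0 by apply/andP; rewrite -negb_or -mulf_eq0 -mE.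
(* After cancelling [k], this is the numerator of the derivative of [n / m] over [k * s ^+ 2]; being
   prime to [s], it leaves a pole of order at least two at every zero of [s]. *)
have copsX : coprimep s (n^`() * s + - (n * w)).
  rewrite coprimep_addl_mul -mulNr coprimepMr cop andbT -scaleN1r.
  rewrite coprimepZr ?oppr_eq0 ?oner_eq0 //.
  by rewrite coprimep_sym (coprimep_dvdl _ copnm) // mE dvdp_mull.
have E1 : c * k * s ^+ 2 = d * (n^`() * s - n * w).
  by move: E; rewrite m'E mE => E; apply: (mulfI k0); ring: E.
have /dvdpP[d1 dE] : s %| d.
  by rewrite -(Gauss_dvdpl _ copsX) -E1 expr2 mulrA dvdp_mull.
have copsd : coprimep s d1.
  by move: sepd; rewrite dE separable_mul coprimep_sym => /and3P[].
(* The denominator [d = d1 * s] cancels only one factor of [s ^+ 2], so [s] divides a product of two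
   factors prime to it and is constant. *)
have /eqP s1 : size s == 1%N.
  rewrite -dvdp1 -(Gauss_dvdpr _ copsX) mulr1 -(Gauss_dvdpr _ copsd).
  have -> : d1 * (n^`() * s + - (n * w)) = c * k * s.
    by apply: (mulfI s0); move: E1; rewrite dE => E1; ring: E1.
  exact: dvdp_mull.
have [l mE'] : exists l, m = l%:P.
  apply/deriv_eq0/dvd_deriv_eq0; rewrite m'E mE dvdp_mul //.
  by rewrite (dvdp_trans _ (dvd1p w)) // dvdp1 s1.
have l0 : l != 0 by rewrite -polyC_eq0 -mE'.
(* Now [m] is a nonzero constant, so [d] divides [c], which degrees forbid unless [c = 0]. *)
apply/eqP; apply: contraTT (ltcd) => c0; rewrite -leqNgt dvdp_leq //.
rewrite -(dvdpZr _ _ (expf_neq0 2 l0)) -mul_polyC rmorphXn /= -mE' mulrC E.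
exact: dvdp_mulr.
Qed.

(** The common denominator is the least common multiple, which stays squarefree where the product
    might not; so proper fractions with squarefree denominator are closed under subtraction. *)
Lemma separable_sub c1 d1 c2 d2 : separable_poly d1 -> separable_poly d2 ->
  (size c1 < size d1)%N -> (size c2 < size d2)%N ->
  exists c d e1 e2, [/\ separable_poly d, (size c < size d)%N,
    d = d1 * e1, d = d2 * e2 & c = c1 * e1 - c2 * e2].
Proof.
move=> sep1 sep2 lt1 lt2; set k := gcdp d1 d2.
have /dvdpP[e2 d1E] : k %| d1 by apply: dvdp_gcdl.
have /dvdpP[e1 d2E] : k %| d2 by apply: dvdp_gcdr.
have d0 := separable_poly_neq0 sep1; have d0' := separable_poly_neq0 sep2.
have k0 : k != 0 by rewrite gcdp_eq0 negb_and d0.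
have cop : coprimep e2 e1.
  have := @coprimep_div_gcd _ d1 d2; rewrite d0 -/k => /(_ isT).
  by rewrite [X in X %/ _]d1E [X in coprimep _ (X %/ _)]d2E !mulpK.
have dE : d1 * e1 = d2 * e2 by rewrite d1E d2E; ring.
have e10 : e1 != 0 by apply: contraNneq d0' => z; rewrite d2E z mul0r.
have e20 : e2 != 0 by apply: contraNneq d0 => z; rewrite d1E z mul0r.
exists (c1 * e1 - c2 * e2), (d1 * e1), e1, e2; split => //.
  rewrite separable_mul sep1 /=; move: sep2; rewrite d2E separable_mul.
  by case/and3P=> -> _ cope; rewrite d1E coprimepMl cop coprimep_sym.
have lt_mul c d e : e != 0 -> (size c < size d)%N ->
    (size (c * e)%R < size (d * e)%R)%N.
  move=> e0 cd; have [->|c0] := eqVneq c 0.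
    rewrite mul0r size_poly0 size_poly_gt0 mulf_neq0 //.
    by rewrite -size_poly_gt0 (leq_ltn_trans _ cd).
  rewrite !size_mul // -?size_poly_gt0 ?(leq_ltn_trans _ cd) //.
  move: e0; rewrite -size_poly_gt0; case: (size e) => // i _.
  by rewrite !addnS ltn_add2r.
rewrite (leq_ltn_trans (size_polyD _ _)) // size_polyN gtn_max.
by rewrite lt_mul //= dE lt_mul.
Qed.
End PolynomialsInCharacteristicZero.

(** * A derivation and a commuting difference operator on a field of fractions *)

(* [F] plays the role of the fraction field of [{poly L}], with [iota] the
   embedding, [D] the derivation and [theta] an automorphism fixing ['X]. *)
Section DifferenceDerivation.
Variables (L F : fieldType) (iota : {rmorphism {poly L} -> F}).
Variables (D : {additive F -> F}) (sigma : {rmorphism L -> L}).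
Variable theta : {rmorphism F -> F}.
Hypothesis charL : [pchar L] =i pred0.
Hypothesis iota_inj : injective iota.
Hypothesis iota_frac :
  forall f, exists a b : {poly L}, b != 0 /\ f = iota a / iota b.
Hypothesis DM : forall f g, D (f * g) = D f * g + f * D g.
Hypothesis D_iota : forall p, D (iota p) = iota p^`().
Hypothesis theta_iota : forall p, theta (iota p) = iota (map_poly sigma p).
Implicit Types (a b c d p : {poly L}) (f g h : F).

Lemma iota_eq0 p : (iota p == 0) = (p == 0).
Proof. by rewrite -(rmorph0 iota) (inj_eq iota_inj). Qed.

Lemma derivation_div f g : g != 0 -> D (f / g) = (D f * g - f * D g) / g ^+ 2.
Proof.
move=> g0; have : D (f / g * g) = D f by rewrite divfK.
by rewrite DM => <-; field.
Qed.

Lemma derivation_frac n m : m != 0 ->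
  D (iota n / iota m) = iota (n^`() * m - n * m^`()) / iota m ^+ 2.
Proof.
by move=> m0; rewrite derivation_div ?iota_eq0 // !D_iota rmorphB !rmorphM.
Qed.

Lemma iota_reduced f :
  exists c d, [/\ d \is monic, coprimep c d & f = iota c / iota d].
Proof.
have [a [b [b0 ->]]] := iota_frac f.
have [c [d [dm cop E]]] := coprime_fraction a b0.
exists c, d; split=> //; apply/eqP.
by rewrite eqr_div ?iota_eq0 ?(monic_neq0 dm) // -!rmorphM E.
Qed.

(** Induction on the degree of the denominator: [hermite_step] lowers it until it is squarefree; the
    polynomial part left then has an antiderivative. *)
Lemma hermite_reduction f : exists h c d,
  [/\ separable_poly d, (size c < size d)%N & f = D h + iota c / iota d].
Proof.
have [a [b [b0 ->]]] := iota_frac f.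
have [n] := ubnP (size b); elim: n a b b0 => // n IHn a b b0 ltbn.
have [sepb|nsepb] := boolP (separable_poly b).
  have [p pE] := deriv_surj charL (a %/ b).
  exists (iota p), (a %% b), b; split; rewrite ?ltn_modp //.
  rewrite {1}(divp_eq a b) D_iota pE rmorphD rmorphM.
  by field; rewrite iota_eq0.
have [g [s [k [c [d [bE ks0 ltksb E]]]]]] := hermite_step charL a b0 nsepb.
have [h [c1 [d1 [sep lt E1]]]] := IHn d (k * s) ks0 (leq_trans ltksb ltbn).
have [g0 s0] : g != 0 /\ s != 0 by apply/andP; rewrite -negb_or -mulf_eq0 -bE.
have k0 : k != 0 by apply: contraNneq ks0 => ->; rewrite mul0r.
exists (iota c / iota g + h), c1, d1; split=> //.
rewrite raddfD -addrA -E1 derivation_frac // bE !rmorphM.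
have : iota a = (iota (c^`() * g - c * g^`()) * iota s * iota k
                 + iota d * iota g ^+ 2) / (iota g * iota k).
  rewrite -!rmorphM -!rmorphXn -!rmorphM -rmorphD -E !rmorphM.
  by field; rewrite !iota_eq0 k0 g0.
by move=> ->; field; rewrite !iota_eq0 k0 g0 s0.
Qed.

Lemma simple_exact_eq0 c d g : separable_poly d -> (size c < size d)%N ->
  iota c / iota d = D g -> iota c / iota d = 0.
Proof.
move=> sepd lt; have [n [m [mm cop ->]]] := iota_reduced g.
have m0 := monic_neq0 mm.
rewrite derivation_frac // => /eqP.
rewrite eqr_div ?expf_neq0 ?iota_eq0 ?(separable_poly_neq0 sepd) //.
rewrite -rmorphXn -!rmorphM (inj_eq iota_inj) => /eqP E.
rewrite (simple_derivative_eq0 charL sepd lt m0 cop) ?rmorph0 ?mul0r //.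
by rewrite E mulrC.
Qed.

Lemma derivation_eq0 g : D g = 0 -> exists l, g = iota l%:P.
Proof.
have [n [m [mm cop ->]]] := iota_reduced g.
have m0 := monic_neq0 mm.
rewrite derivation_frac // => /eqP.
rewrite mulf_eq0 invr_eq0 expf_eq0 !iota_eq0 (negPf m0) orbF subr_eq0 => /eqP E.
have m'0 : m^`() = 0.
  apply: dvd_deriv_eq0 => //; rewrite coprimep_sym in cop.
  by rewrite -(Gauss_dvdpr _ cop) -E dvdp_mull.
have [k kE] := deriv_eq0 charL m'0.
have /(deriv_eq0 charL)[l lE] : n^`() = 0.
  by apply: (mulIf m0); rewrite E m'0 mulr0 mul0r.
exists (l / k); rewrite polyCM rmorphM kE lE -[X in X^-1]/(iota _).
have k0 : k != 0 by rewrite -polyC_eq0 -kE.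
congr (_ * _); apply: (mulfI (x := iota k%:P)); first by rewrite iota_eq0 -kE.
by rewrite -rmorphM -polyCM !divff ?rmorph1 ?iota_eq0 -?kE.
Qed.

(** [theta] acts on coefficients only, and formal differentiation commutes with such an action. *)
Lemma derivation_theta f : D (theta f) = theta (D f).
Proof.
have [a [b [b0 ->]]] := iota_frac f.
have b0' : map_poly sigma b != 0 by rewrite map_poly_eq0.
rewrite fmorph_div !theta_iota !derivation_frac // fmorph_div.
by rewrite rmorphXn !theta_iota !deriv_map [in RHS]rmorphB !rmorphM.
Qed.

Lemma theta_fixed_frac f : theta f = f -> exists c d,
  [/\ f = iota c / iota d, d != 0, map_poly sigma c = c & map_poly sigma d = d].
Proof.
have [c [d [dm cop ->]]] := iota_reduced f => /eqP.
have d0 := monic_neq0 dm.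
have d0' : map_poly sigma d != 0 by rewrite map_poly_eq0.
rewrite fmorph_div !theta_iota eqr_div ?iota_eq0 // -!rmorphM.
rewrite (inj_eq iota_inj) => /eqP E.
(* Coprimality makes [d] divide its image, and both are monic of the same degree. *)
have dE : map_poly sigma d = d.
  apply/eqP; rewrite eq_sym -eqp_monic ?monic_map // -dvdp_size_eqp.
    by rewrite size_map_poly.
  rewrite coprimep_sym in cop.
  by rewrite -(Gauss_dvdpr _ cop) -E dvdp_mull.
exists c, d; split=> //.
by apply: (mulIf d0); rewrite E dE.
Qed.

Lemma theta_exact_fixed f g : theta f - f = D g -> exists h r l,
  [/\ f = D h + r, theta r = r & g = theta h - h + iota l%:P].
Proof.
have [h [c [d [sep lt ->]]]] := hermite_reduction f.
set r := _ / _ => E.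
(* As [theta] commutes with [D], the part [D h] of [f] contributes the derivative of [theta h - h],
   which moves to the right. *)
have {}E : theta r - r = D (g - (theta h - h)).
  by rewrite !raddfB derivation_theta -E rmorphD /=; ring.
have thr : theta r - r = 0.
  have sep' : separable_poly (map_poly sigma d) by rewrite separable_map.
  have lt' : (size (map_poly sigma c) < size (map_poly sigma d))%N.
    by rewrite !size_map_poly.
  have [c1 [d1 [e1 [e2 [sep1 lt1 dE1 dE2 cE]]]]] :=
    separable_sub sep' sep lt' lt.
  have rE : theta r - r = iota c1 / iota d1.
    have d10 := separable_poly_neq0 sep1.
    have [x0 y0] : map_poly sigma d != 0 /\ e1 != 0.
      by apply/andP; rewrite -negb_or -mulf_eq0 -dE1.
    have [z0 t0] : d != 0 /\ e2 != 0.
      by apply/andP; rewrite -negb_or -mulf_eq0 -dE2.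
    have -> : iota c1 / iota d1 = iota (map_poly sigma c) * iota e1 / iota d1
                                  - iota c * iota e2 / iota d1.
      by rewrite cE rmorphB !rmorphM mulrBl.
    rewrite /r fmorph_div !theta_iota {1}dE1 dE2 !rmorphM -!mulf_div.
    by rewrite !divff ?iota_eq0 // !mulr1.
  by rewrite rE; apply: simple_exact_eq0 sep1 lt1 _; rewrite -rE E.
have [l lE] : exists l, g - (theta h - h) = iota l%:P.
  by apply: derivation_eq0; rewrite -E thr.
exists h, r, l; split=> //; first by apply/eqP; rewrite -subr_eq0 thr.
by rewrite -lE addrC subrK.
Qed.
End DifferenceDerivation.

(** * Fraction fields and the morphisms induced on them *)

Lemma tofrac_inj (R : idomainType) : injective (@FracField.tofrac R).
Proof. by move=> p q /eqP; rewrite tofrac_eq => /eqP. Qed.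

Section FieldIdentities.
Variables (F : fieldType) (n d m e n' d' m' e' : F).
Hypotheses (d0 : d != 0) (e0 : e != 0).

Lemma subf_div : n / d - m / e = (n * e - m * d) / (d * e).
Proof. by field; rewrite d0 e0. Qed.

(** The primed letters stand for derivatives but are independent field elements, so the rules for
    [Dy] become plain identities for [field]. *)
Lemma subf_quotient_rule :
  ((n' * e + n * e' - (m' * d + m * d')) * (d * e)
     - (n * e - m * d) * (d' * e + d * e')) / (d * e) ^+ 2
  = (n' * d - n * d') / d ^+ 2 - (m' * e - m * e') / e ^+ 2.
Proof. by field; rewrite d0 e0. Qed.

Lemma mulf_quotient_rule :
  ((n' * m + n * m') * (d * e) - n * m * (d' * e + d * e')) / (d * e) ^+ 2
  = (n' * d - n * d') / d ^+ 2 * (m / e) + n / d * ((m' * e - m * e') / e ^+ 2).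
Proof. by field; rewrite d0 e0. Qed.
End FieldIdentities.

Lemma fraction_div (R : idomainType) (f : {fraction R}) :
  exists n d : R, d != 0 /\ f = n%:F / d%:F.
Proof.
exists \n_(repr f), \d_(repr f); split; first exact: denom_ratioP.
rewrite -[LHS]reprK -[in LHS](Ratio_numden (repr f)); unlock FracField.tofrac.
rewrite -[(_)^-1]FracField.pi_inv -[RHS]FracField.pi_mul; congr (\pi_(_)%qT _).
rewrite /FracField.mulf /FracField.invf.
by rewrite !numden_Ratio ?oner_eq0 ?denom_ratioP ?mulr1 ?mul1r.
Qed.

Section FractionMorphism.
Variables (R S : idomainType) (phi : {rmorphism R -> S}).
Hypothesis phi_inj : injective phi.

(* [fracmap phi] is a morphism only for injective [phi]: the proof is an argument
   so that the instances below can be attached to this constant. *)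
Definition fracmorph of injective phi := fracmap phi.
Local Notation phiF := (fracmorph phi_inj).

Lemma fracmorph_div n d : d != 0 ->
  phiF (n%:F / d%:F) = (phi n)%:F / (phi d)%:F.
Proof. exact: fracmap_div. Qed.

Let tofrac_phi_neq0 d : d != 0 -> (phi d)%:F != 0.
Proof. by rewrite tofrac_eq0 -(inj_eq phi_inj) rmorph0. Qed.

Lemma fracmorph_zmod_morphism : zmod_morphism phiF.
Proof.
move=> f g; have [n [d [d0 ->]]] := fraction_div f.
have [m [e [e0 ->]]] := fraction_div g.
rewrite subf_div ?tofrac_eq0 // -!tofracM -tofracB.
rewrite !fracmorph_div ?mulf_neq0 // rmorphB !rmorphM tofracB !tofracM.
by rewrite subf_div ?tofrac_phi_neq0.
Qed.

Lemma fracmorph_monoid_morphism : monoid_morphism phiF.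
Proof.
split=> [|f g].
  have -> : 1 = 1%:F / 1%:F :> {fraction R} by rewrite divr1.
  by rewrite fracmorph_div ?oner_neq0 // rmorph1 divr1.
have [n [d [d0 ->]]] := fraction_div f.
have [m [e [e0 ->]]] := fraction_div g.
rewrite mulf_div -!tofracM !fracmorph_div ?mulf_neq0 // !rmorphM.
by rewrite mulf_div.
Qed.

HB.instance Definition _ := GRing.isZmodMorphism.Build {fraction R} {fraction S}
  phiF fracmorph_zmod_morphism.
HB.instance Definition _ := GRing.isMonoidMorphism.Build {fraction R}
  {fraction S} phiF fracmorph_monoid_morphism.

Lemma fracmorph_tofrac n : phiF n%:F = (phi n)%:F.
Proof.
by rewrite -[n%:F]divr1 -tofrac1 fracmorph_div ?oner_neq0 // rmorph1 divr1.
Qed.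
End FractionMorphism.

(** * The derivation with respect to y on K(x,y) *)

Section DerivationY.
Variable K : fieldType.

Lemma Dy_tofrac (n : {poly {poly K}}) : Dy n%:F = (n^`())%:F.
Proof.
rewrite -[n%:F]divr1 -tofrac1 Dy_div ?oner_neq0 //.
by rewrite derivC mulr0 subr0 mulr1 expr1n divr1.
Qed.

Lemma Dy_zmod_morphism : zmod_morphism (@Dy K).
Proof.
move=> f g; have [n [d [d0 ->]]] := fraction_div f.
have [m [e [e0 ->]]] := fraction_div g.
rewrite subf_div ?tofrac_eq0 // -!tofracM -tofracB.
rewrite !Dy_div ?mulf_neq0 // derivB !derivM.
rewrite !(tofracM, tofracB, tofracD, tofracXn).
by rewrite subf_quotient_rule ?tofrac_eq0.
Qed.

HB.instance Definition _ := GRing.isZmodMorphism.Build (ratxy K) (ratxy K)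
  (@Dy K) Dy_zmod_morphism.

Lemma DyM (f g : ratxy K) : Dy (f * g) = Dy f * g + f * Dy g.
Proof.
have [n [d [d0 ->]]] := fraction_div f.
have [m [e [e0 ->]]] := fraction_div g.
rewrite mulf_div -!tofracM !Dy_div ?mulf_neq0 // !derivM.
rewrite !(tofracM, tofracB, tofracD, tofracXn).
by rewrite mulf_quotient_rule ?tofrac_eq0.
Qed.

Lemma Dy_ofKx (l : {fraction {poly K}}) : Dy (ofKx l) = 0.
Proof.
have [n [d [d0 ->]]] := fraction_div l.
rewrite /ofKx fracmap_div //; last exact: polyC_inj.
by rewrite Dy_div ?polyC_eq0 // !derivC mul0r mulr0 subr0 tofrac0 mul0r.
Qed.
End DerivationY.

(** * Elements of K(x) fixed by a substitution *)

Section FixedElements.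
Variable K : fieldType.

Lemma vanish_on_sequence (z : nat -> K) (p : {poly K}) : injective z ->
  (forall i, p.[z i] = 0) -> p = 0.
Proof.
move=> z_inj pz; apply/eqP; apply/negPn/negP => p0.
have rp : all (root p) (mkseq z (size p)).
  by apply/allP => _ /mapP[i _ ->]; apply/eqP.
by have := max_poly_roots p0 rp (mkseq_uniq _ z_inj); rewrite size_mkseq ltnn.
Qed.

(* [z] is an infinite orbit of the substitution [t]; a reduced fraction fixed
   by the substitution has no pole on it and is constant along it. *)
Lemma fixed_fraction_const (t : {poly K}) (t_inj : injective (comp_poly t))
    (z : nat -> K) (l : {fraction {poly K}}) :
  injective z -> (forall i, t.[z i] = z i.+1) ->
  fracmap (comp_poly t) l = l -> exists k, l = k%:P%:F.
Proof.
move=> z_inj tz; have [a [b [b0 ->]]] := fraction_div l.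
have [n [d [dm cop E]]] := coprime_fraction a b0.
have d0 := monic_neq0 dm.
have {a b b0 E} -> : a%:F / b%:F = n%:F / d%:F.
  by apply/eqP; rewrite eqr_div ?tofrac_eq0 // -!tofracM E.
have nz p : p != 0 -> (p \Po t)%:F != 0.
  by rewrite tofrac_eq0 -(inj_eq t_inj) comp_poly0.
rewrite fracmap_div // => /eqP; rewrite eqr_div ?nz ?tofrac_eq0 //.
rewrite -!tofracM tofrac_eq => /eqP E.
have step i : n.[z i.+1] * d.[z i] = n.[z i] * d.[z i.+1].
  by move: (congr1 (horner^~ (z i)) E); rewrite !hornerM !horner_comp tz.
(* A zero of [d] at one point of the orbit is not a zero of [n], so by [step] it propagates to the
   next point, giving [d] infinitely many roots. *)
have dz i : d.[z i] != 0.
  apply/eqP => di; move/eqP: d0; apply.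
  apply: (@vanish_on_sequence (fun j => z (i + j)%N)) => [j k /z_inj/addnI //|].
  elim=> [|j IHj]; first by rewrite addn0.
  have := step (i + j)%N; rewrite IHj mulr0 addnS => /esym/eqP.
  rewrite mulf_eq0 => /orP[|/eqP //] nz0.
  by have := coprimep_root cop nz0; rewrite IHj eqxx.
have nE : n = (n.[z 0] / d.[z 0]) *: d.
  apply/eqP; rewrite -subr_eq0; apply/eqP.
  apply: (vanish_on_sequence z_inj) => i.
  rewrite !hornerE; apply/eqP; rewrite subr_eq0; apply/eqP.
  elim: i => [|i IHi]; first by rewrite divfK.
  by apply: (mulIf (dz i)); rewrite step IHi mulrAC.
exists (n.[z 0] / d.[z 0]).
by rewrite {1}nE -mul_polyC tofracM mulfK // tofrac_eq0.
Qed.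
End FixedElements.

(** * K(x,y) as the fraction field of K(x)[y], and substitutions in x *)

Lemma map_poly_lift (R S : nzRingType) (phi : {rmorphism R -> S})
    (p : {poly S}) :
  (forall i, exists k, p`_i = phi k) -> exists q, p = map_poly phi q.
Proof.
elim/poly_ind: p => [|p c IHp] pE; first by exists 0; rewrite rmorph0.
have [i|q ->] := IHp.
  by have := pE i.+1; rewrite coefD coefMX coefC addr0.
have [k] := pE 0; rewrite coefD coefMX coefC add0r => ->.
by exists (q * 'X + k%:P); rewrite rmorphD rmorphM /= map_polyX map_polyC.
Qed.

Lemma clear_denominators (R : idomainType) (F : fieldType)
    (phi : {rmorphism R -> F}) (p : {poly F}) : injective phi ->
    (forall c, exists n d : R, d != 0 /\ c = phi n / phi d) ->
  exists (d : R) q, d != 0 /\ phi d *: p = map_poly phi q.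
Proof.
move=> phi_inj frac; elim/poly_ind: p => [|p c [d [q [d0 E]]]].
  by exists 1, 0; rewrite oner_neq0 scaler0 rmorph0.
have [n [e [e0 ->]]] := frac c.
have phie0 : phi e != 0 by rewrite -(rmorph0 phi) (inj_eq phi_inj).
exists (d * e), (e%:P * q * 'X + (d * n)%:P); split; first exact: mulf_neq0.
rewrite rmorphD !rmorphM /= map_polyX !map_polyC /= -E -!mul_polyC.
rewrite mulrDr !rmorphM /= -!polyCM; congr (_ + _).
  by rewrite polyCM; ring.
by rewrite mulrACA divff // mulr1.
Qed.

Lemma derivation_horner (L F : comNzRingType) (phi : {rmorphism L -> F})
    (D : {additive F -> F}) (y : F) (p : {poly L}) :
    (forall f g, D (f * g) = D f * g + f * D g) ->
    (forall l, D (phi l) = 0) -> D y = 1 ->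
  D (map_poly phi p).[y] = (map_poly phi p^`()).[y].
Proof.
move=> DM Dphi Dy1; elim/poly_ind: p => [|p c IHp].
  by rewrite deriv0 rmorph0 horner0 raddf0.
rewrite derivD derivM derivX derivC mulr1 addr0 !rmorphD !rmorphM /=.
by rewrite map_polyX map_polyC !hornerE raddfD /= DM IHp Dphi Dy1 addr0 mulr1.
Qed.

Section Substitution.
Variables (K : fieldType) (t : {poly K}).
Hypothesis charK : [pchar K] =i pred0.
Hypothesis t_inj : injective (comp_poly t).
Local Notation L := {fraction {poly K}}.

Lemma map_comp_inj : injective (map_poly (comp_poly t)).
Proof. by apply: map_inj_poly; rewrite ?comp_poly0. Qed.

Local Notation ofKxM := (fracmorph (@polyC_inj {poly K})).
Local Notation sigma := (fracmorph t_inj).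
Local Notation theta := (fracmorph map_comp_inj).
Local Notation Y := ('X%:F : ratxy K).

Let commY : commr_rmorph ofKxM Y. Proof. by move=> l; apply: mulrC. Qed.
(** Evaluation at y embeds K(x)[y] in K(x,y), which is built from K[x][y]; the abstract argument
    needs coefficients in the field K(x). *)
Let iota : {rmorphism {poly L} -> ratxy K} := horner_morph commY.

Lemma iota_tofrac (p : {poly {poly K}}) :
  iota (map_poly (@FracField.tofrac _) p) = p%:F.
Proof.
rewrite /iota /= /horner_morph -map_poly_comp.
rewrite (eq_map_poly (g := @FracField.tofrac _ \o polyC)); last first.
  by move=> c; rewrite /= fracmorph_tofrac.
by rewrite map_poly_comp horner_map -[_.[_]]/(p \Po 'X) comp_polyXr.
Qed.

(** Clearing denominators turns a kernel element into a polynomial of K[x][y], on which [iota] is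
    the canonical embedding. *)
Lemma iota_inj : injective iota.
Proof.
apply: raddf_inj => p p0; have [d [q [d0 E]]] :=
  clear_denominators p (@tofrac_inj _) (@fraction_div _).
have q0 : q = 0.
  apply/eqP; rewrite -tofrac_eq0 -iota_tofrac -E.
  by rewrite -mul_polyC rmorphM p0 mulr0.
apply/eqP; have /eqP := E; rewrite q0 rmorph0 scaler_eq0 tofrac_eq0.
by rewrite (negPf d0).
Qed.

Lemma iota_frac_xy f : exists a b : {poly L}, b != 0 /\ f = iota a / iota b.
Proof.
have [n [d [d0 ->]]] := fraction_div f.
exists (map_poly (@FracField.tofrac _) n), (map_poly (@FracField.tofrac _) d).
rewrite !iota_tofrac; split=> //.
by rewrite -(inj_eq iota_inj) iota_tofrac rmorph0 tofrac_eq0.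
Qed.

Lemma iotaC l : iota l%:P = ofKx l.
Proof. exact: horner_morphC. Qed.

Lemma Dy_iota p : Dy (iota p) = iota p^`().
Proof.
apply: derivation_horner; [exact: DyM | exact: Dy_ofKx |].
by rewrite [LHS]Dy_tofrac derivX tofrac1.
Qed.

Lemma theta_iota_xy p : theta (iota p) = iota (map_poly sigma p).
Proof.
have thetaY : theta Y = Y by rewrite fracmorph_tofrac /= map_polyX.
rewrite -[iota p]/((map_poly ofKxM p).[Y]) -horner_map -!map_poly_comp.
congr (_.[_]); last exact: thetaY.
rewrite -[RHS]map_poly_comp; apply: eq_map_poly => l /=.
have [n [d [d0 ->]]] := fraction_div l.
have d0' : d \Po t != 0 by rewrite -(comp_poly0 t) (inj_eq t_inj).
by rewrite !fracmorph_div ?polyC_eq0 // /= !map_polyC.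
Qed.

(** Treats the shift and the q-shift together: each is an injective substitution with an infinite
    orbit [z] in K. *)
Lemma substitution_exact_fixed (z : nat -> K) (f g : ratxy K) :
    injective z -> (forall i, t.[z i] = z i.+1) ->
    fracmap (map_poly (comp_poly t)) f - f = Dy g ->
  exists (h : ratxy K) (u v : L), f = Dy h + ofKy u
    /\ g = fracmap (map_poly (comp_poly t)) h - h + ofKx v.
Proof.
move=> z_inj tz E.
pose embK : {rmorphism K -> L} := @FracField.tofrac _ \o polyC.
have charL : [pchar L] =i pred0.
  by move=> p; rewrite (fmorph_pchar embK).
have [h [r [v [fE thr gE]]]] := theta_exact_fixed charL iota_inj iota_frac_xy
  (@DyM K) Dy_iota theta_iota_xy E.
have [c [d [rE d0 cE dE]]] :=
  theta_fixed_frac iota_inj iota_frac_xy theta_iota_xy thr.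
(* Each coefficient is an element of K(x) fixed by the substitution, hence a constant; this puts [r]
   in K(y). *)
have fixed_lift p : map_poly sigma p = p ->
    exists p0 : {poly K}, iota p = (map_poly polyC p0)%:F.
  move=> pE.
  have [i|p0 ->] := @map_poly_lift _ _ embK p.
    apply: (fixed_fraction_const t_inj z_inj tz).
    by rewrite -{2}pE coef_map.
  by exists p0; rewrite map_poly_comp iota_tofrac.
have [c0 c0E] := fixed_lift _ cE; have [e0 e0E] := fixed_lift _ dE.
exists h, (c0%:F / e0%:F), v; split; last by rewrite -iotaC.
rewrite fE rE c0E e0E /ofKy fracmap_div //; first exact: polyC_map_inj.
apply: contraNneq d0 => e00; rewrite -(inj_eq iota_inj) e0E e00.
by rewrite !rmorph0.
Qed.
End Substitution.

(** * Infinite orbits of the shift and of the q-shift *)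

Theorem theorem4 (K : closedFieldType) (charK : [pchar K] =i pred0)
    (q : K) (q_neq0 : q != 0)
    (q_not_unity : forall n : nat, (0 < n)%N -> ~~ n.-unity_root q)
    (theta : ratxy K -> ratxy K)
    (theta_def : theta = @sigmax K \/ theta = taux q)
    (f g : ratxy K) (fg : theta f - f = Dy g) :
  exists (h : ratxy K) (u v : {fraction {poly K}}),
    f = Dy h + ofKy u /\ g = theta h - h + ofKx v.
Proof.
case: theta_def fg => ->.
  (* The orbit of 0 under the shift; its points are distinct in characteristic zero. *)
  apply: (substitution_exact_fixed charK _ (z := fun i => i%:R)).
  - by have := @comp_poly_lin_inj K 1 1 (oner_neq0 _); rewrite scale1r.
  - move=> i j; wlog le_ij : i j / (i <= j)%N => [wlg E|/esym/eqP].
      by case/orP: (leq_total i j) => /wlg -> //; rewrite E.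
    rewrite -subr_eq0 -natrB // (pcharf0P K).1 // subn_eq0 => le_ji.
    by apply/eqP; rewrite eqn_leq le_ij.
  - by move=> i; rewrite !hornerE -natr1.
(* The orbit of 1 under multiplication by [q]; its points are distinct because [q] is nonzero and
   not a root of unity. *)
apply: (substitution_exact_fixed charK _ (z := fun i => q ^+ i)).
- by have := @comp_poly_lin_inj K q 0 q_neq0; rewrite addr0.
- move=> i j; wlog le_ij : i j / (i <= j)%N => [wlg E|/eqP].
    by case/orP: (leq_total i j) => /wlg -> //; rewrite E.
  rewrite -[q ^+ i]mulr1 -(subnK le_ij) addnC exprD.
  rewrite (inj_eq (mulfI (expf_neq0 i q_neq0))) eq_sym -unity_rootE => u.
  apply/eqP; rewrite subnKC // eqn_leq le_ij -subn_eq0 -leqn0 leqNgt.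
  by apply/negP => /q_not_unity/negP.
- by move=> i; rewrite !hornerE exprS.
Qed.
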